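(* Let $(\mathcal{B},\blacktriangleright)$ be the quandle on $\mathcal{B}=\{0,1\}^{\mathbb{Z}}$ described in the context, and let $\alpha,\beta,\gamma\in\mathcal{B}$ be given by $\alpha_i=1$ if $i=0$ and $\alpha_i=0$ otherwise; $\beta_i=1$ if $i\le 0$ and $\beta_i=0$ if $i>0$; $\gamma_i=1$ for all $i$. Let $\mathcal{B}_0=\{\ell^j(\alpha),\ell^j(\beta),\gamma: j\in\mathbb{Z}\}$. Then $(\mathcal{B}_0,\blacktriangleright)$ is a subquandle of $(\mathcal{B},\blacktriangleright)$ with finite quandle presentation $$\langle \alpha,\beta,\gamma : \alpha\blacktriangleright\beta=\alpha,\ \beta\blacktriangleright\alpha=\beta,\ \gamma\blacktriangleright\alpha=\gamma,\ \gamma\blacktriangleright\beta=\gamma\rangle,$$ and the restriction to $\mathcal{B}_0$ of the equivalence relation $\sim$ defined by $a\sim b\Leftrightarrow a_i=b_i$ for all $i\ge0$ is a $\blacktriangleright$-congruence on $\mathcal{B}_0$ that is not a $\blacktriangleleft$-congruence.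
   Context: A quandle is a set with a binary operation $\vartriangleright$ that is idempotent ($x\vartriangleright x=x$), right self-distributive ($(x\vartriangleright y)\vartriangleright z=(x\vartriangleright z)\vartriangleright(y\vartriangleright z)$) and right invertible (for all $y,z$ there is a unique $x$ with $x\vartriangleright y=z$). A subquandle is a subset that is itself a quandle under the same operation. A quandle homomorphism is a map $\phi$ between quandles preserving the primary operation. Let $\ell,r:\mathcal{B}\to\mathcal{B}$ be the left- and right-shift operators $(\ell(a))_i=a_{i+1}$, $(r(a))_i=a_{i-1}$. Write $a\simeq b$ if there exist $s,t\in\mathbb{Z}$ such that $\ell^s(a)\sim\ell^t(b)$, where $a\sim b$ means $a_i=b_i$ for all $i\ge 0$. Define $a\blacktriangleright b=a$ if $a\simeq b$ and $\ell(a)$ if $a\not\simeq b$; $a\blacktriangleleft b=a$ if $a\simeq b$ and $r(a)$ if $a\not\simeq b$. Then $(\mathcal{B},\blacktriangleright)$ is a quandle with inverse operation $\blacktriangleleft$. To say $(\mathcal{B}_0,\blacktriangleright)$ has the stated presentation means that the stated relations hold in $\mathcal{B}_0$ and the following universal property holds: for every quandle $(Q,\vartriangleright)$ and elements $a,b,c\in Q$ with $a\vartriangleright b=a$, $b\vartriangleright a=b$, $c\vartriangleright a=c$, $c\vartriangleright b=c$, there is a unique quandle homomorphism $\mathcal{B}_0\to Q$ with $\alpha\mapsto a$, $\beta\mapsto b$, $\gamma\mapsto c$. For a binary operation $*$ on a set $M$, an equivalence relation $\sim$ on $M$ is a $*$-congruence if $a\sim c$ and $b\sim d$ imply $a*b\sim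 c*d$, for all $a,b,c,d\in M$. *)

(* Defs.v *)
From mathcomp Require Import all_boot all_order all_algebra.
From mathcomp Require Import boolp classical_sets.

Set Implicit Arguments.
Unset Strict Implicit.
Unset Printing Implicit Defensive.

Import Order.TTheory GRing.Theory Num.Theory.
Local Open Scope classical_set_scope.
Local Open Scope ring_scope.

Definition is_quandle (T : Type) (op : T -> T -> T) : Prop :=
  [/\ forall x, op x x = x,
      forall x y z, op (op x y) z = op (op x z) (op y z)
    & forall y z, exists! x, op x y = z].

Definition quandle_hom (T U : Type) (opT : T -> T -> T) (opU : U -> U -> U)
    (f : T -> U) : Prop :=
  forall x y, f (opT x y) = opU (f x) (f y).

Definition closed_under (T : Type) (op : T -> T -> T) (A : set T) : Prop :=
  forall x y, A x -> A y -> A (op x y).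

Definition restrict_op (T : Type) (op : T -> T -> T) (A : set T)
    (opA : closed_under op A) (x y : A) : A :=
  SigSub (mem_set (opA _ _ (set_valP x) (set_valP y))).

Definition restrict_rel (T : Type) (R : T -> T -> Prop) (A : set T)
    (x y : A) : Prop :=
  R (val x) (val y).

Record subquandle (T : Type) (op : T -> T -> T) (A : set T) : Prop := {
  subquandle_ambient : is_quandle op;
  subquandle_closed : closed_under op A;
  subquandle_quandle : is_quandle (restrict_op subquandle_closed)
}.

Definition congruence (T : Type) (op : T -> T -> T) (R : T -> T -> Prop) :
    Prop :=
  RelationClasses.Equivalence R /\
  forall a b c d, R a c -> R b d -> R (op a b) (op c d).

Definition relations (T : Type) (op : T -> T -> T) (a b c : T) : Prop :=
  [/\ op a b = a, op b a = b, op c a = c & op c b = c].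

(* The quandle (P, opP) has the presentation                                  *)
(*   < x, y, z : x * y = x, y * x = y, z * x = z, z * y = z >,                *)
(* expressed by the universal property.                                       *)
Definition has_presentation (P : Type) (opP : P -> P -> P) (x y z : P) : Prop :=
  relations opP x y z /\
  forall (Q : Type) (opQ : Q -> Q -> Q), is_quandle opQ ->
  forall a b c : Q, relations opQ a b c ->
  exists! f : P -> Q,
    quandle_hom opP opQ f /\ [/\ f x = a, f y = b & f z = c].

Definition biseq : Type := int -> bool.

Definition shiftl (a : biseq) : biseq := fun i => a (i + 1).
Definition shiftr (a : biseq) : biseq := fun i => a (i - 1).

(* The integer power shiftl^j, where shiftr is the inverse of shiftl.         *)
Definition shiftz (j : int) (a : biseq) : biseq :=
  match j with
  | Posz n => iter n shiftl a
  | Negz n => iter n.+1 shiftr a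
  end.

Lemma shiftzE (j : int) (a : biseq) (i : int) : shiftz j a i = a (i + j).
Proof.
have shiftrE k i' : iter k shiftr a i' = a (i' - k%:Z).
  elim: k i' => [|k IHk] i'; first by rewrite subr0.
  by rewrite iterS [LHS]IHk -addrA -opprD -intS.
case: j => n; last exact: shiftrE.
elim: n i => [|n IHn] i; first by rewrite addr0.
by rewrite [LHS]IHn -addrA -intS.
Qed.

Definition sim (a b : biseq) : Prop := forall i : int, 0 <= i -> a i = b i.

Definition simeq (a b : biseq) : Prop :=
  exists s t : int, sim (shiftz s a) (shiftz t b).

Definition bright (a b : biseq) : biseq :=
  if `[< simeq a b >] then a else shiftl a.
Definition bleft (a b : biseq) : biseq :=
  if `[< simeq a b >] then a else shiftr a.

Definition alpha : biseq := fun i => i == 0.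
Definition beta : biseq := fun i => i <= 0.
Definition gamma : biseq := fun=> true.

Definition B0 : set biseq :=
  [set x | [\/ exists j : int, x = shiftz j alpha,
               exists j : int, x = shiftz j beta
             | x = gamma]].

Lemma alpha_in_B0 : B0 alpha. Proof. by constructor 1; exists 0. Qed.
Lemma beta_in_B0 : B0 beta. Proof. by constructor 2; exists 0. Qed.
Lemma gamma_in_B0 : B0 gamma. Proof. by constructor 3. Qed.

Definition alpha0 : B0 := SigSub (mem_set alpha_in_B0).
Definition beta0 : B0 := SigSub (mem_set beta_in_B0).
Definition gamma0 : B0 := SigSub (mem_set gamma_in_B0).

(* Main.v *)
Require Import Defs.
From mathcomp Require Import all_boot all_order all_algebra.
From mathcomp Require Import boolp classical_sets.
From mathcomp Require Import zify.

(** The whole argument runs on orbits of right translation by the third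
    generator.  Call [o : int -> T] an orbit of [c] when [o (j + 1)] is
    [o j * c].  In a quandle, an orbit of [c] is determined by [o 0], and every
    element starts one ([orbit_ext], [orbit_exists]).

    The key lemma is [orbit_fix]: if [o 0 * o' 0 = o 0] and [c * o' 0 = c], then
    [o j * o' k = o j] for all [j] and [k].  Indeed, [c * o' 0 = c] says that
    right translation by [o' 0] commutes with that by [c], so it fixes the
    orbit [o] pointwise once it fixes [o 0]; and right translation by [o' k] is
    the conjugate of that by [o' 0] by a power of that by [c], hence equal to it.
    As the constant map [c] is itself an orbit, the lemma also gives
    [c * o' k = c].

    Hence the four relations determine all products of elements in the orbits of
    the three generators.  In [B0] these orbits are [j |-> shiftz j e] for
    [e = alpha, beta, gamma]: they exhaust [B0], and they have no coincidences
    beyond the constancy of the third.  So sending the orbit of each generator to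
    the orbit of its prescribed image is well defined, is a homomorphism because
    both multiplication tables are the one computed from [orbit_fix], and is the
    only homomorphism possible because orbits are determined by their origin.

    Finally, [sim] refines [simeq], on which alone it depends whether [bright]
    shifts, and the entries of [shiftl a] at indices [>= 0] are among those of
    [a], whence the congruence.  By contrast [bleft] brings the entry at [-1] to
    [0]: [shiftl alpha] and [shiftl (shiftl alpha)] are related by [sim], but
    after [bleft] by [gamma] they become [alpha] and [shiftl alpha], which differ
    at [0]. *)

Set Implicit Arguments.
Unset Strict Implicit.
Unset Printing Implicit Defensive.

Import Order.TTheory GRing.Theory Num.Theory.
Local Open Scope classical_set_scope.
Local Open Scope ring_scope.

(** * Orbits of a right translation in a quandle *)

Lemma int_step_ind (P : int -> Prop) :
  P 0 -> (forall j, P j -> P (j + 1)) -> (forall j, P (j + 1) -> P j) ->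
  forall j, P j.
Proof.
move=> P0 Pup Pdown; elim=> [//|n IHn|n IHn].
  by rewrite intS addrC; exact: Pup.
by apply: Pdown; have -> : - n.+1%:Z + 1 = - n%:Z by lia.
Qed.

Definition is_orbit (T : Type) (op : T -> T -> T) (c : T) (o : int -> T) :=
  forall j, o (j + 1) = op (o j) c.

Section Orbits.
Variables (T : Type) (op : T -> T -> T).
Hypothesis qT : is_quandle op.

Lemma quandle_cancel c x y : op x c = op y c -> x = y.
Proof.
case: qT => _ _ /(_ c (op y c)) [z [_ zuniq]] exy.
by rewrite -(zuniq x exy) -(zuniq y erefl).
Qed.

Lemma const_orbit c : is_orbit op c (fun=> c).
Proof. by move=> j; case: qT => ->. Qed.

Lemma orbit_ext c o o' :
  is_orbit op c o -> is_orbit op c o' -> o 0 = o' 0 -> forall j, o j = o' j.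
Proof.
move=> orb_o orb_o' eq0; apply: int_step_ind => // j.
  by rewrite orb_o orb_o' => ->.
by rewrite orb_o orb_o' => /quandle_cancel.
Qed.

Lemma orbit_exists c a : exists o, is_orbit op c o /\ o 0 = a.
Proof.
have /choice[inv invP] : forall z, exists x, op x c = z.
  by move=> z; case: qT => _ _ /(_ c z) [x [<- _]]; exists x.
exists (fun j => match j with
  | Posz n => iter n (op^~ c) a
  | Negz n => iter n.+1 inv a end); split=> // -[n|[|n]].
- by rewrite -PoszD addn1.
- by rewrite /= invP.
- have -> : Negz n.+1 + 1 = Negz n by rewrite !NegzE; lia.
  by rewrite [in RHS]iterS invP.
Qed.

(** Right translation by [o' 0] commutes with right translation by [c], so both
    inductions propagate in either direction by self-distributivity. *)
Lemma orbit_fix c o o' :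
  is_orbit op c o -> is_orbit op c o' ->
  op (o 0) (o' 0) = o 0 -> op c (o' 0) = c ->
  forall j k, op (o j) (o' k) = o j.
Proof.
case: (qT) => _ distr _ orb_o orb_o' fix0 fixc j k.
elim/int_step_ind: k j => [|k IHk|k IHk] j.
- elim/int_step_ind: j => [//|j IHj|j].
    by rewrite orb_o distr fixc IHj.
  by rewrite orb_o distr fixc => /quandle_cancel.
- have -> : j = j - 1 + 1 by lia.
  by rewrite orb_o orb_o' -distr IHk.
- by apply: (@quandle_cancel c); rewrite distr -orb_o -orb_o' IHk.
Qed.

End Orbits.

(** * The quandle of two-sided binary sequences *)

Lemma shiftlE a : shiftl a = shiftz 1 a. Proof. by []. Qed.

Lemma shiftrE a : shiftr a = shiftz (- 1) a. Proof. by []. Qed.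

Lemma shiftzD j k a : shiftz j (shiftz k a) = shiftz (j + k) a.
Proof. by apply/funext => i; rewrite !shiftzE addrA. Qed.

Lemma shiftl_shiftr a : shiftl (shiftr a) = a.
Proof. by rewrite shiftlE shiftrE shiftzD. Qed.

Lemma shiftr_shiftl a : shiftr (shiftl a) = a.
Proof. by rewrite shiftlE shiftrE shiftzD. Qed.

(** Only the relative displacement [d] of the two tails matters; in this form
    transitivity amounts to adding displacements. *)
Lemma simeqP a b :
  simeq a b <-> exists d N : int, forall i : int, N <= i -> a i = b (i + d).
Proof.
split=> [[s [t st]]|[d [N dN]]].
  exists (t - s), s => i le_si; have := st (i - s).
  rewrite !shiftzE subrK => -> //; last by lia.
  by congr b; lia.
exists N, (N + d) => i i_ge0; rewrite !shiftzE dN; last by lia.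
by congr b; lia.
Qed.

Lemma sim_simeq a b : sim a b -> simeq a b.
Proof. by exists 0, 0. Qed.

Lemma simeq_refl a : simeq a a.
Proof. exact: sim_simeq. Qed.

Lemma simeq_sym a b : simeq a b -> simeq b a.
Proof.
by move=> [s [t st]]; exists t, s => i i_ge0; rewrite st.
Qed.

Lemma simeq_trans b a c : simeq a b -> simeq b c -> simeq a c.
Proof.
move=> /simeqP[d [N dN]] /simeqP[d' [N' dN']]; apply/simeqP.
exists (d + d'), (Num.max N (N' - d)) => i le_i.
by rewrite dN ?dN'; first (by congr c; lia); lia.
Qed.

Lemma simeq_shiftz j a : simeq (shiftz j a) a.
Proof. by exists 0, j. Qed.

Lemma asbool_simeq a b c d :
  simeq a c -> simeq b d -> `[< simeq a b >] = `[< simeq c d >].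
Proof.
move=> ac bd; apply: asbool_equiv_eq; split=> [ab|cd].
  exact: simeq_trans (simeq_sym ac) (simeq_trans ab bd).
exact: simeq_trans ac (simeq_trans cd (simeq_sym bd)).
Qed.

Lemma simeq_bright a b : simeq (bright a b) a.
Proof.
by rewrite /bright; case: ifP => _; [exact: simeq_refl | exact: simeq_shiftz 1 a].
Qed.

Lemma simeq_bleft a b : simeq (bleft a b) a.
Proof.
by rewrite /bleft; case: ifP => _; [exact: simeq_refl | exact: simeq_shiftz (- 1) a].
Qed.

Lemma brightK a b : bleft (bright a b) b = a.
Proof.
rewrite /bleft (asbool_simeq (simeq_bright a b) (simeq_refl b)) /bright.
by case: asbool => //; rewrite shiftr_shiftl.
Qed.

Lemma bleftK a b : bright (bleft a b) b = a.
Proof.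
rewrite /bright (asbool_simeq (simeq_bleft a b) (simeq_refl b)) /bleft.
by case: asbool => //; rewrite shiftl_shiftr.
Qed.

(** Whether [bright] shifts depends only on the [simeq]-classes of its
    arguments, which [bright] preserves. *)
Lemma bright_quandle : is_quandle bright.
Proof.
split=> [a|a b c|b c].
- by rewrite /bright asboolT //; exact: simeq_refl.
- have -> : bright (bright a c) (bright b c)
            = if `[< simeq a b >] then bright a c else shiftl (bright a c).
    by rewrite {1}/bright (asbool_simeq (simeq_bright a c) (simeq_bright b c)).
  rewrite {1}/bright.
  rewrite (asbool_simeq (simeq_bright a b) (simeq_refl c)) /bright.
  by case: `[< simeq a b >]; case: `[< simeq a c >].
- exists (bleft c b); split=> [|a <-]; [exact: bleftK | exact: brightK].
Qed.

Lemma bright_sim a b c d : sim a c -> sim b d -> sim (bright a b) (bright c d).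
Proof.
move=> ac bd.
rewrite /bright (asbool_simeq (sim_simeq ac) (sim_simeq bd)).
by case: ifP => _ // i i_ge0; apply: ac; lia.
Qed.

(** * The subset generated by the three sequences *)

Lemma shiftz_gamma j : shiftz j gamma = gamma.
Proof. by apply/funext => i; rewrite shiftzE. Qed.

Lemma simeq_alpha_beta : simeq alpha beta.
Proof.
by exists 1, 1 => i i_ge0; rewrite !shiftzE /alpha /beta; lia.
Qed.

Lemma alpha_nsimeq_gamma : ~ simeq alpha gamma.
Proof.
case/simeqP=> d [N alphaN].
have : alpha (Num.max N 1) = true by rewrite alphaN //; lia.
by rewrite /alpha; lia.
Qed.

Lemma beta_nsimeq_gamma : ~ simeq beta gamma.
Proof.
move=> beta_gamma; apply: alpha_nsimeq_gamma.
exact: simeq_trans simeq_alpha_beta beta_gamma.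
Qed.

Lemma generator_relations : relations bright alpha beta gamma.
Proof.
split; rewrite /bright.
- by rewrite asboolT //; exact: simeq_alpha_beta.
- by rewrite asboolT //; exact/simeq_sym/simeq_alpha_beta.
- by case: ifP.
- by case: ifP.
Qed.

Lemma B0_shiftz j x : B0 x -> B0 (shiftz j x).
Proof.
case=> [[k ->]|[k ->]|->].
- by constructor 1; exists (j + k); rewrite shiftzD.
- by constructor 2; exists (j + k); rewrite shiftzD.
- by constructor 3; rewrite shiftz_gamma.
Qed.

Lemma B0_bright : closed_under bright B0.
Proof.
by move=> x y Bx _; rewrite /bright; case: ifP => // _; exact: B0_shiftz 1 x Bx.
Qed.

Lemma B0_bleft : closed_under bleft B0.
Proof.
move=> x y Bx _; rewrite /bleft; case: ifP => // _; exact: B0_shiftz (- 1) x Bx.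
Qed.

Lemma bright_gamma x : B0 x -> bright x gamma = shiftl x.
Proof.
move=> Bx; rewrite /bright; case: asboolP => // x_gamma.
case: Bx x_gamma => [[k ->]|[k ->]|-> //] x_gamma.
- case: alpha_nsimeq_gamma.
  exact: simeq_trans (simeq_sym (simeq_shiftz k alpha)) x_gamma.
- case: beta_nsimeq_gamma.
  exact: simeq_trans (simeq_sym (simeq_shiftz k beta)) x_gamma.
Qed.

Lemma restrict_bright_quandle (cB : closed_under bright B0) :
  is_quandle (restrict_op cB).
Proof.
case: bright_quandle => idem distr _; split=> [x|x y z|y z].
- by apply: val_inj; exact: idem.
- by apply: val_inj; exact: distr.
- exists (SigSub (mem_set (B0_bleft (set_valP z) (set_valP y)))).
  split=> [|x <-]; apply: val_inj; [exact: bleftK | exact: brightK].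
Qed.

Definition shift0 (x : B0) (j : int) : B0 :=
  SigSub (mem_set (B0_shiftz j (set_valP x))).

Lemma shift0_0 x : shift0 x 0 = x.
Proof. exact: val_inj. Qed.

Lemma shift0_gamma j : shift0 gamma0 j = gamma0.
Proof. by apply: val_inj; exact: shiftz_gamma. Qed.

Lemma B0_shift0P (x : B0) :
  exists j, [\/ x = shift0 alpha0 j, x = shift0 beta0 j | x = gamma0].
Proof.
case: (set_valP x) => [[j xE]|[j xE]|xE].
- by exists j; constructor 1; exact: val_inj.
- by exists j; constructor 2; exact: val_inj.
- by exists 0; constructor 3; exact: val_inj.
Qed.

Lemma shift0_orbit (cB : closed_under bright B0) x :
  is_orbit (restrict_op cB) gamma0 (shift0 x).
Proof.
move=> j; apply: val_inj => /=.
rewrite (bright_gamma (B0_shiftz j (set_valP x))) shiftlE shiftzD.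
by rewrite [1 + j]addrC.
Qed.

Lemma shift0_alpha_inj j k : shift0 alpha0 j = shift0 alpha0 k -> j = k.
Proof.
move=> /(congr1 val) /= /(congr1 (fun x => x (- j))).
by rewrite !shiftzE /alpha; lia.
Qed.

Lemma shift0_beta_inj j k : shift0 beta0 j = shift0 beta0 k -> j = k.
Proof.
move=> /(congr1 val) /= jk.
have := congr1 (fun x => x (- j)) jk; have := congr1 (fun x => x (- k)) jk.
by rewrite !shiftzE /beta; lia.
Qed.

Lemma shift0_alpha_beta j k : shift0 alpha0 j <> shift0 beta0 k.
Proof.
move=> /(congr1 val) /= jk.
(* [beta] takes the value [true] at both [0] and [-1]. *)
have := congr1 (fun x => x (- k)) jk; have := congr1 (fun x => x (- k - 1)) jk.
by rewrite !shiftzE /alpha /beta; lia.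
Qed.

Lemma shift0_alpha_gamma j : shift0 alpha0 j <> gamma0.
Proof.
move=> /(congr1 val) /= /(congr1 (fun x => x (1 - j))).
by rewrite !shiftzE /alpha /gamma; lia.
Qed.

Lemma shift0_beta_gamma j : shift0 beta0 j <> gamma0.
Proof.
move=> /(congr1 val) /= /(congr1 (fun x => x (1 - j))).
by rewrite !shiftzE /beta /gamma; lia.
Qed.

(** The orbits of the generators are disjoint and the first two are injectively
    parametrised, so prescribing a function orbit by orbit is consistent. *)
Lemma B0_map_exists (Q : Type) (oa ob : int -> Q) (c : Q) :
  exists f : B0 -> Q,
    [/\ forall j, f (shift0 alpha0 j) = oa j,
        forall j, f (shift0 beta0 j) = ob j & f gamma0 = c].
Proof.
have /choice[f fP] : forall x : B0, exists q,
    [/\ forall j, x = shift0 alpha0 j -> q = oa j,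
        forall j, x = shift0 beta0 j -> q = ob j & x = gamma0 -> q = c].
  move=> x; have [j [->|->|->]] := B0_shift0P x.
  - exists (oa j); split=> [k /shift0_alpha_inj -> //|k|].
    + by move/shift0_alpha_beta.
    + by move/shift0_alpha_gamma.
  - exists (ob j); split=> [k|k /shift0_beta_inj -> //|].
    + by move/esym/shift0_alpha_beta.
    + by move/shift0_beta_gamma.
  - exists c; split=> [k|k|//].
    + by move/esym/shift0_alpha_gamma.
    + by move/esym/shift0_beta_gamma.
exists f; split=> [j|j|].
- by case: (fP (shift0 alpha0 j)) => /(_ j erefl).
- by case: (fP (shift0 beta0 j)) => _ /(_ j erefl).
- by case: (fP gamma0) => _ _ /(_ erefl).
Qed.

(** * The presentation *)

Lemma hom_orbit (T U : Type) (opT : T -> T -> T) (opU : U -> U -> U)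
    (f : T -> U) c o :
  quandle_hom opT opU f -> is_orbit opT c o ->
  is_orbit opU (f c) (fun j => f (o j)).
Proof. by move=> homf orb_o j; rewrite orb_o homf. Qed.

Lemma B0_relations (cB : closed_under bright B0) :
  relations (restrict_op cB) alpha0 beta0 gamma0.
Proof.
by case: generator_relations => ab ba ca cb; split; exact: val_inj.
Qed.

(** Each product of two elements of [B0] is governed either by the orbit
    equation, when the second factor is [gamma0], or by [orbit_fix], applied
    both in [B0] and in the target. *)
Lemma orbit_map_hom (cB : closed_under bright B0)
    (Q : Type) (opQ : Q -> Q -> Q) (a b c : Q) (oa ob : int -> Q)
    (f : B0 -> Q) :
  is_quandle opQ -> relations opQ a b c ->
  is_orbit opQ c oa -> oa 0 = a -> is_orbit opQ c ob -> ob 0 = b ->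
  (forall j, f (shift0 alpha0 j) = oa j) ->
  (forall j, f (shift0 beta0 j) = ob j) -> f gamma0 = c ->
  quandle_hom (restrict_op cB) opQ f.
Proof.
move=> qQ relQ orb_oa oa0 orb_ob ob0 fa fb fc.
have qB := restrict_bright_quandle cB.
pose matched (e : B0) (o : int -> Q) :=
  is_orbit opQ c o /\ forall j, f (shift0 e j) = o j.
have ma : matched alpha0 oa by [].
have mb : matched beta0 ob by [].
have mc : matched gamma0 (fun=> c).
  by split=> [|j]; [exact: const_orbit | rewrite shift0_gamma].
have hom_fix e o e' o' : matched e o -> matched e' o' ->
    restrict_op cB e e' = e -> restrict_op cB gamma0 e' = gamma0 ->
    opQ (o 0) (o' 0) = o 0 -> opQ c (o' 0) = c ->
    forall j k, f (restrict_op cB (shift0 e j) (shift0 e' k))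
                = opQ (f (shift0 e j)) (f (shift0 e' k)).
  move=> [orb_o fo] [orb_o' fo'] ee' ge' oo' co' j k.
  rewrite (orbit_fix qB (@shift0_orbit cB e) (@shift0_orbit cB e')) ?shift0_0 //.
  by rewrite fo fo' (orbit_fix qQ orb_o orb_o').
have hom_gamma e o : matched e o ->
    forall j, f (restrict_op cB (shift0 e j) gamma0)
              = opQ (f (shift0 e j)) (f gamma0).
  by move=> [orb_o fo] j; rewrite -shift0_orbit !fo fc orb_o.
case: (B0_relations cB) => ab ba ca cb.
case: relQ => abQ baQ caQ cbQ.
case: (qB) => idB _ _; case: (qQ) => idQ _ _.
have hom_gen e o : matched e o ->
    restrict_op cB e alpha0 = e -> restrict_op cB e beta0 = e ->
    opQ (o 0) a = o 0 -> opQ (o 0) b = o 0 ->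
    forall j y, f (restrict_op cB (shift0 e j) y)
                = opQ (f (shift0 e j)) (f y).
  move=> meo ea eb eaQ ebQ j y; have [k [->|->|->]] := B0_shift0P y.
  - by apply: (hom_fix _ _ _ _ meo ma); rewrite ?oa0.
  - by apply: (hom_fix _ _ _ _ meo mb); rewrite ?ob0.
  - exact: hom_gamma meo j.
move=> x y; have [j [->|->|->]] := B0_shift0P x.
- by apply: (hom_gen _ _ ma); rewrite ?oa0.
- by apply: (hom_gen _ _ mb); rewrite ?ob0.
- by rewrite -(shift0_gamma 0); apply: (hom_gen _ _ mc).
Qed.

Lemma B0_presentation (cB : closed_under bright B0) :
  has_presentation (restrict_op cB) alpha0 beta0 gamma0.
Proof.
split; first exact: B0_relations.
move=> Q opQ qQ a b c relQ.
have [oa [orb_oa oa0]] := orbit_exists qQ c a.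
have [ob [orb_ob ob0]] := orbit_exists qQ c b.
have [f [fa fb fc]] := B0_map_exists oa ob c.
exists f; split.
  split; first exact: (orbit_map_hom cB qQ relQ orb_oa oa0 orb_ob ob0 fa fb fc).
  by rewrite -oa0 -fa -ob0 -fb !shift0_0.
move=> g [homg [ga gb gc]].
have orb_g e := hom_orbit homg (@shift0_orbit cB e).
rewrite gc in orb_g.
apply/funext => x; have [j [->|->|->]] := B0_shift0P x.
- by rewrite fa; apply: (orbit_ext qQ orb_oa (orb_g alpha0)); rewrite shift0_0 ga.
- by rewrite fb; apply: (orbit_ext qQ orb_ob (orb_g beta0)); rewrite shift0_0 gb.
- by rewrite fc gc.
Qed.

(** * The one-sided congruence *)

Lemma restrict_sim_equivalence :
  RelationClasses.Equivalence (@restrict_rel _ sim B0).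
Proof.
split=> [x i //|x y xy i i_ge0|x y z xy yz i i_ge0]; first by rewrite xy.
by rewrite xy // yz.
Qed.

Lemma sim_bright_congruence (cB : closed_under bright B0) :
  congruence (restrict_op cB) (@restrict_rel _ sim B0).
Proof.
split; first exact: restrict_sim_equivalence.
by move=> a b c d; exact: bright_sim.
Qed.

Lemma bleft_gamma x : B0 x -> bleft x gamma = shiftr x.
Proof.
move=> Bx; rewrite -[in LHS](shiftl_shiftr x) -bright_gamma ?brightK //.
exact: B0_shiftz (- 1) x Bx.
Qed.

Lemma sim_shiftz_alpha : sim (shiftz 1 alpha) (shiftz 2 alpha).
Proof. by move=> i i_ge0; rewrite !shiftzE /alpha; lia. Qed.

Lemma sim_not_bleft_congruence (cB : closed_under bleft B0) :
  ~ congruence (restrict_op cB) (@restrict_rel _ sim B0).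
Proof.
have bleft_alpha j : bleft (shiftz j alpha) gamma = shiftz (- 1 + j) alpha.
  by rewrite bleft_gamma ?shiftrE ?shiftzD //; exact: B0_shiftz alpha_in_B0.
case=> _ cong.
have : sim (bleft (shiftz 1 alpha) gamma) (bleft (shiftz 2 alpha) gamma).
  by apply: (cong (shift0 alpha0 1) gamma0 (shift0 alpha0 2) gamma0);
    first exact: sim_shiftz_alpha.
by rewrite !bleft_alpha => /(_ 0 (lexx 0)); rewrite !shiftzE.
Qed.

Theorem mainTheorem3 :
  (exists SB0 : subquandle bright B0,
     has_presentation (restrict_op (subquandle_closed SB0)) alpha0 beta0 gamma0
     /\ congruence (restrict_op (subquandle_closed SB0)) (@restrict_rel _ sim B0))
  /\ (exists cB0 : closed_under bleft B0,
        ~ congruence (restrict_op cB0) (@restrict_rel _ sim B0)).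
Proof.
split; last by exists B0_bleft; exact: sim_not_bleft_congruence.
exists (Build_subquandle bright_quandle (restrict_bright_quandle B0_bright)).
by split; [exact: B0_presentation | exact: sim_bright_congruence].
Qed.
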